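(* Having zero follower entropy is a conjugacy invariant: if $X$ and $Y$ are conjugate nonempty two-sided shift spaces (over possibly different finite alphabets) and $h_F(X) = 0$, then $h_F(Y) = 0$.
   Context: A two-sided shift space over a finite alphabet $A$ is a subset $X \subset A^{\mathbb{Z}}$ which is closed (product topology) and invariant under the left shift $\sigma$, $(\sigma x)(n) = x(n+1)$. Two shift spaces $X, Y$ are conjugate if there is a continuous bijection $\varphi: X \to Y$ with $\varphi\circ\sigma = \sigma\circ\varphi$. The language $L(X)$ is the set of all finite words appearing in points of $X$, and $L_n(X)$ is the set of words of length $n$ in $L(X)$. For $w \in L(X)$, the follower set $F_X(w)$ is the set of all words $u \in L(X)$ such that $wu$ occurs in some point of $X$. Set $F_X(n) = \{F_X(w) : w \in L_n(X)\}$. The follower entropy is $h_F(X) = \limsup_{n\to\infty}\frac{1}{n}\log|F_X(n)|$. *)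

(* Defs.v *)
From mathcomp Require Import all_boot all_order all_algebra.
From mathcomp Require Import finmap.
From mathcomp Require Import all_classical all_reals all_analysis.

Set Implicit Arguments.
Unset Strict Implicit.
Unset Printing Implicit Defensive.

Import Order.TTheory GRing.Theory Num.Theory.

Local Open Scope classical_set_scope.
Local Open Scope ring_scope.

(* [discrete_topology A] is [A] itself, carrying the discrete topology, so this
   is the function type [int -> A] with the product topology. *)
Definition config (A : finType) := {ptws int -> discrete_topology A}.

Definition left_shift (A : finType) (x : config A) : config A :=
  fun n : int => x (n + 1).

(* Invariance under the invertible map [left_shift] means equality, not merely
   inclusion of [left_shift @` X] in [X]. *)
Definition shift_space (A : finType) (X : set (config A)) : Prop :=
  closed X /\ @left_shift A @` X = X.

(* A map between the subspaces [X] and [Y] is represented by a total function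
   whose values outside [X] are irrelevant. *)
Definition conjugate_shifts (A B : finType) (X : set (config A)) (Y : set (config B))
    : Prop :=
  exists phi : config A -> config B,
    [/\ {within X, continuous phi},
        set_bij X Y phi &
        forall x, X x -> phi (left_shift x) = left_shift (phi x)].

(* The word x(i) x(i+1) ... x(i+n-1). *)
Definition word_at (A : finType) (x : config A) (i : int) (n : nat) : seq A :=
  mkseq (fun k => x (i + k%:Z)) n.

Definition occurs (A : finType) (w : seq A) (x : config A) : Prop :=
  exists i : int, word_at x i (size w) = w.

Definition language (A : finType) (X : set (config A)) : set (seq A) :=
  [set w | exists2 x, X x & occurs w x].

Definition language_of_length (A : finType) (X : set (config A)) (n : nat)
    : set (seq A) :=
  [set w | language X w /\ size w = n].

Definition follower_set (A : finType) (X : set (config A)) (w : seq A)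
    : set (seq A) :=
  [set u | language X u /\ exists2 x, X x & occurs (w ++ u) x].

Definition follower_sets (A : finType) (X : set (config A)) (n : nat)
    : set (set (seq A)) :=
  follower_set X @` language_of_length X n.

(* [fset_set] is only meaningful on finite sets. *)
Lemma finite_follower_sets (A : finType) (X : set (config A)) (n : nat) :
  finite_set (follower_sets X n).
Proof.
apply: finite_image.
apply: (@sub_finite_set _ _ ((@tval n A) @` setT)).
  by move=> w [_ sw]; exists (tcast sw (in_tuple w)) => //; rewrite val_tcast.
exact/finite_image/finite_finset.
Qed.

(* The term of index 0 is ln(...) / 0 = 0, which does not affect the limsup. *)
Definition follower_entropy (R : realType) (A : finType) (X : set (config A))
    : \bar R :=
  limn_esup (fun n => (n%:R^-1 * ln (#|` fset_set (follower_sets X n)|%:R))%:E).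

(* Main.v *)
(* By compactness, the conjugacy phi : X -> Y and its inverse are sliding block
   codes, with radii r and s.  A word w of length n in Y comes from words v of
   length n + 2r in X.  As w determines v except for its two end blocks of
   length r + s, there are boundedly many such v.  The follower set of w is the
   union over these v of a set that depends only on the last 2r letters of v and
   on the follower set of v.  Hence |F_Y(n)| <= (C |F_X(n + 2r)| + 1)^K, where C
   and K do not depend on n. *)
Require Import Defs.
From mathcomp Require Import all_boot all_order all_algebra.
From mathcomp Require Import finmap.
From mathcomp Require Import all_classical all_reals all_analysis.
From mathcomp Require Import zify ring.

Set Implicit Arguments.
Unset Strict Implicit.
Unset Printing Implicit Defensive.

Import Order.TTheory GRing.Theory Num.Theory.
Import numFieldNormedType.Exports.
Local Open Scope classical_set_scope.

(** * Compactness and finite windows *)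

(** Compactness of [X * X]: a pair with equal values of [f] keeps them nearby, and any other pair is
    separated by some [g i], which still separates nearby pairs. Finitely many such neighbourhoods
    give one bound [s]. *)
Lemma finite_window (T : topologicalType) (C D : Type) (X : set T)
    (f : T -> C) (g : int -> T -> D) :
  compact X ->
  (forall x, X x -> \forall z \near within X (nbhs x), f z = f x) ->
  (forall i x, X x -> \forall z \near within X (nbhs x), g i z = g i x) ->
  (forall x z, X x -> X z -> (forall i, g i x = g i z) -> f x = f z) ->
  exists s : nat, forall x z, X x -> X z ->
    (forall i, (`|i| <= s)%N -> g i x = g i z) -> f x = f z.
Proof.
move=> cX cf cg fg.
have /compact_near_coveringP/near_covering_withinP cov := compact_setX cX cX.
pose P (s : nat) (xz : T * T) :=
  (forall i, (`|i| <= s)%N -> g i xz.1 = g i xz.2) -> f xz.1 = f xz.2.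
have near2 (E : Type) (h : T -> E) x z : X x -> X z ->
    (forall x, X x -> \forall z \near within X (nbhs x), h z = h x) ->
    \forall p \near (x, z), (X `*` X) p -> h p.1 = h x /\ h p.2 = h z.
  move=> Xx Xz ch; exists ([set u | X u -> h u = h x], [set u | X u -> h u = h z]).
    by split; exact: ch.
  by move=> p [/= hx hz] [/hx ? /hz ?].
have [|s _ /(_ s (leqnn s)) sP] := cov nat \oo P _; last first.
  by exists s => x z Xx Xz; exact: (sP (x, z)).
move=> [x z] [/= Xx Xz]; have [fxz|fxz] := pselect (f x = f z).
  exists ([set p | (X `*` X) p -> f p.1 = f x /\ f p.2 = f z], setT).
    by have fN := near2 _ f x z Xx Xz cf; split; [exact: fN|exact: filterT].
  by move=> [p s] [/= + _] XXp _ => /(_ XXp)[-> ->].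
have /existsNP[i gi] : ~ forall i, g i x = g i z by move=> /(fg _ _ Xx Xz).
exists ([set p | (X `*` X) p -> g i p.1 = g i x /\ g i p.2 = g i z], [set s | (`|i| <= s)%N]).
  by have gN := near2 _ (g i) x z Xx Xz (cg i); split; [exact: gN|exact: nbhs_infty_ge].
by move=> [p s] [/= + +] XXp => /(_ XXp)[gx gz] ls /(_ i ls); rewrite gx gz.
Qed.

Lemma closed_config_compact (A : finType) (X : set (config A)) :
  closed X -> compact X.
Proof.
move=> clX; apply: (subclosed_compact clX (B := setT)) => //.
have -> : [set: config A] =
    [set f | forall i : int, [set: discrete_topology A] (f i)].
  by apply/seteqP; split.
apply: (@tychonoff int (fun=> discrete_topology A) (fun=> setT)) => i.
by apply: finite_compact; exact: finite_finset.
Qed.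

Lemma near_coord (A : finType) (x : config A) i :
  \forall z \near x, z i = x i.
Proof.
exact: (@proj_continuous int (fun=> discrete_topology A) i x _
  (@discrete_set1 (discrete_topology A) (x i))).
Qed.

Lemma card_fset_set_le_range (fT : finType) (T : choiceType) (f : fT -> T)
    (S : set T) : S `<=` range f -> (#|` fset_set S| <= #|fT|)%N.
Proof.
move=> Sf; have finS : finite_set S.
  by apply: (sub_finite_set Sf); exact/finite_image/finite_finset.
have /fsubset_leq_card/leq_trans : (fset_set S `<=` [fset f t | t in fT])%fset.
  apply/fsubsetP => x; rewrite in_fset_set// inE => /Sf[t _ <-].
  by apply/imfsetP; exists t.
by apply; rewrite cardE; exact: leq_imfset_card.
Qed.

(** * Words, shifts and follower sets *)

Lemma size_word_at (A : finType) (x : config A) i n : size (word_at x i n) = n.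
Proof. exact: size_mkseq. Qed.

Lemma word_at_eqP (A : finType) (x z : config A) (i j : int) (n : nat) :
  word_at x i n = word_at z j n <->
  forall k : nat, (k < n)%N -> x (i + k%:Z)%R = z (j + k%:Z)%R.
Proof.
split=> [xz k kn|xz].
  by have := congr1 (nth (x i) ^~ k) xz; rewrite !nth_mkseq.
apply/eq_in_map => k; rewrite mem_iota add0n => /andP[_]; exact: xz.
Qed.

Lemma word_atD (A : finType) (x : config A) (i : int) (m n : nat) :
  word_at x i (m + n) = word_at x i m ++ word_at x (i + m%:Z) n.
Proof.
rewrite /word_at /mkseq iotaD map_cat; congr (_ ++ _).
rewrite add0n -[m in iota m]addn0 iotaDl -map_comp; apply: eq_map => k /=.
by rewrite PoszD addrA.
Qed.

Definition shift_by (A : finType) (i : int) (x : config A) : config A :=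
  fun n => x (n + i)%R.

Lemma word_at_shift_by (A : finType) (x : config A) (i j : int) (n : nat) :
  word_at (shift_by i x) j n = word_at x (j + i) n.
Proof. by apply/word_at_eqP => k _; rewrite /shift_by addrAC. Qed.

(** Negative shifts rest on invariance being an equality: every point of [X] is the left shift of a
    point of [X]. *)
Lemma shift_by_mem (A : finType) (X : set (config A)) (i : int) x :
  shift_space X -> X x -> X (shift_by i x).
Proof.
move=> [_ sX]; elim/int_ind: i x => [|n IH|n IH] x Xx.
- suff -> : shift_by 0 x = x by [].
  by apply/funext => k; rewrite /shift_by addr0.
- rewrite -sX; exists (shift_by n x); first exact: IH.
  by apply/funext => k; rewrite /shift_by /left_shift; congr x; lia.
- move: Xx; rewrite -{1}sX => -[z Xz <-].
  suff -> : shift_by (- n.+1%:Z) (left_shift z) = shift_by (- n%:Z) z by exact: IH.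
  by apply/funext => k; rewrite /shift_by /left_shift; congr z; lia.
Qed.

(** Shift invariance moves any occurrence of the concatenated word to position [i], so that follower
    words can be handled through points at fixed coordinates. *)
Lemma follower_setP (A : finType) (X : set (config A)) (x : config A)
    (i : int) (n : nat) (u : seq A) :
  shift_space X ->
  follower_set X (word_at x i n) u <->
  exists2 z, X z & (forall k : nat, (k < n)%N -> z (i + k%:Z)%R = x (i + k%:Z)%R) /\
     word_at z (i + n%:Z) (size u) = u.
Proof.
move=> sX; split=> [[_ [z Xz [j]]]|[z Xz [zx zu]]].
  rewrite size_cat size_word_at word_atD => /eqP.
  rewrite eqseq_cat ?size_word_at// => /andP[/eqP zx /eqP zu].
  exists (shift_by (j - i) z); first exact: shift_by_mem.
  split; last by rewrite word_at_shift_by -[RHS]zu; congr word_at; lia.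
  apply/word_at_eqP; rewrite word_at_shift_by -zx; congr word_at; lia.
split; first by exists z => //; exists (i + n%:Z)%R.
exists z => //; exists i.
by rewrite size_cat size_word_at word_atD zu; congr (_ ++ _); apply/word_at_eqP.
Qed.

Lemma follower_sets_word_at (A : finType) (X : set (config A)) (x : config A)
    (n : nat) :
  X x -> follower_sets X n (follower_set X (word_at x 0 n)).
Proof.
move=> Xx; exists (word_at x 0 n) => //; split; last exact: size_word_at.
by exists x => //; exists 0%R; rewrite size_word_at.
Qed.

Lemma follower_sets_gt0 (A : finType) (X : set (config A)) (n : nat) :
  X !=set0 -> (0 < #|` fset_set (follower_sets X n)|)%N.
Proof.
move=> [x Xx]; rewrite cardfs_gt0; apply/fset0Pn.
exists (follower_set X (word_at x 0 n)).
rewrite in_fset_set; last exact: finite_follower_sets.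
exact/mem_set/follower_sets_word_at.
Qed.

(** * Conjugacies as sliding block codes *)

Section Conjugacy.
Variables (A B : finType) (X : set (config A)) (Y : set (config B)).
Variable phi : config A -> config B.
Hypothesis shiftX : shift_space X.
Hypothesis shiftY : shift_space Y.
Hypothesis phi_cont : {within X, continuous phi}.
Hypothesis phi_bij : set_bij X Y phi.
Hypothesis phi_shift : forall x, X x -> phi (left_shift x) = left_shift (phi x).

Let phi_fun x : X x -> Y (phi x).
Proof. by have [fX _ _] := phi_bij; exact: fX. Qed.

Let phi_surj y : Y y -> exists2 x, X x & phi x = y.
Proof. by have [_ _ sX] := phi_bij => /sX. Qed.

Lemma phi_shift_by (i : int) x : X x -> phi (shift_by i x) = shift_by i (phi x).
Proof.
elim/int_ind: i x => [|n IH|n IH] x Xx.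
- have -> : shift_by 0 x = x by apply/funext => k; rewrite /shift_by addr0.
  by apply/funext => k; rewrite /shift_by addr0.
- have -> : shift_by n.+1 x = left_shift (shift_by n x).
    by apply/funext => k; rewrite /shift_by /left_shift; congr x; lia.
  rewrite phi_shift ?IH//; last exact: shift_by_mem.
  by apply/funext => k; rewrite /shift_by /left_shift; congr (phi x); lia.
- have := Xx; rewrite -{1}shiftX.2 => -[z Xz zx]; rewrite -zx.
  have -> : shift_by (- n.+1%:Z) (left_shift z) = shift_by (- n%:Z) z.
    by apply/funext => k; rewrite /shift_by /left_shift; congr z; lia.
  rewrite IH// phi_shift//.
  by apply/funext => k; rewrite /shift_by /left_shift; congr (phi z); lia.
Qed.

Lemma phi_coord_locally_constant (i : int) x : X x ->
  \forall z \near within X (nbhs x), phi z i = phi x i.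
Proof.
move=> Xx; have /subspace_continuousP/(_ x Xx) := phi_cont.
by move=> /(_ [set y : config B | y i = phi x i]); apply; exact: near_coord.
Qed.

Lemma coord_locally_constant (i : int) (x : config A) :
  \forall z \near within X (nbhs x), z i = x i.
Proof. by apply: (@cvg_within _ (nbhs x)); exact: near_coord. Qed.

(** [finite_window] treats coordinate 0, and commutation with shifts carries the radius to all
    others. Comparing two positions [i] and [j] says that one block map serves everywhere, without
    naming it. *)
Lemma phi_local : exists r : nat, forall (x z : config A) (i j : int), X x -> X z ->
  (forall k : int, (`|k| <= r)%N -> x (i + k)%R = z (j + k)%R) ->
  phi x i = phi z j.
Proof.
have [|x Xx|k x _|x z Xx Xz xz|r rP] := @finite_window (config A) B A X
  (fun x => phi x 0%R) (fun k x => x k).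
- by case: shiftX => clX _; exact: closed_config_compact.
- exact: phi_coord_locally_constant.
- exact: coord_locally_constant.
- by have -> : x = z by apply/funext.
exists r => x z i j Xx Xz xz.
have := rP _ _ (shift_by_mem i shiftX Xx) (shift_by_mem j shiftX Xz).
rewrite !phi_shift_by// /shift_by !add0r; apply => k kr.
by rewrite ![(k + _)%R]addrC xz.
Qed.

(** The coordinates of [phi x] separate points of [X] by injectivity, so [finite_window] yields the
    radius of the inverse directly. *)
Lemma phi_inv_local : exists s : nat, forall (x z : config A) (i j : int), X x -> X z ->
  (forall k : int, (`|k| <= s)%N -> phi x (i + k)%R = phi z (j + k)%R) ->
  x i = z j.
Proof.
have [|x _|k x Xx|x z Xx Xz xz|s sP] := @finite_window (config A) A B X
  (fun x => x 0%R) (fun k x => phi x k).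
- by case: shiftX => clX _; exact: closed_config_compact.
- exact: coord_locally_constant.
- exact: phi_coord_locally_constant.
- have -> // : x = z; have [_ + _] := phi_bij; apply; rewrite ?inE//.
  exact/funext.
exists s => x z i j Xx Xz xz.
have := sP _ _ (shift_by_mem i shiftX Xx) (shift_by_mem j shiftX Xz).
rewrite !phi_shift_by// /shift_by !add0r; apply => k ks.
by rewrite ![(k + _)%R]addrC xz.
Qed.

(** * Counting follower sets across the conjugacy *)

Section Radii.
Variables r s : nat.
Hypothesis rP : forall (x z : config A) (i j : int), X x -> X z ->
  (forall k : int, (`|k| <= r)%N -> x (i + k)%R = z (j + k)%R) ->
  phi x i = phi z j.
Hypothesis sP : forall (x z : config A) (i j : int), X x -> X z ->
  (forall k : int, (`|k| <= s)%N -> phi x (i + k)%R = phi z (j + k)%R) ->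
  x i = z j.

Lemma phi_word x z (i j : int) (n : nat) : X x -> X z ->
  (forall k : nat, (k < n + r.*2)%N -> x (i + k%:Z)%R = z (j + k%:Z)%R) ->
  forall k : nat, (k < n)%N -> phi x (i + r%:Z + k%:Z)%R = phi z (j + r%:Z + k%:Z)%R.
Proof.
move=> Xx Xz xz k kn; apply: rP => // d dr.
have := xz (absz (r%:Z + k%:Z + d)%R) ltac:(lia).
have -> : (`|(r%:Z + k%:Z + d)%R|%N : int) = (r%:Z + k%:Z + d)%R by lia.
by rewrite !addrA.
Qed.

(** The right block is read backwards from position [n + 2r - 1]. For small [n] the blocks may
    overlap or leave the window; the number of possible values is the same for every [n]. *)
Definition word_ends (n : nat) (x : config A) :
    {ffun 'I_(r + s) -> A} * {ffun 'I_(r + s) -> A} :=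
  ([ffun k : 'I_(r + s) => x (Posz k)],
   [ffun k : 'I_(r + s) => x ((n + r.*2)%:Z - 1 - k%:Z)%R]).

(* [phi x] on [r, n + r) determines [x] on [r + s, n + r - s). *)
Lemma word_ends_inj (n : nat) x z : X x -> X z ->
  word_at (phi x) r n = word_at (phi z) r n ->
  word_ends n x = word_ends n z ->
  word_at x 0 (n + r.*2) = word_at z 0 (n + r.*2).
Proof.
move=> Xx Xz /word_at_eqP pxz [/ffunP ends1 /ffunP ends2].
apply/word_at_eqP => k kn; rewrite add0r.
have [krs|krs] := ltnP k (r + s).
  by have := ends1 (Ordinal krs); rewrite !ffunE.
have [knrs|knrs] := ltnP (n + r.*2 - 1 - k) (r + s).
  have := ends2 (Ordinal knrs); rewrite !ffunE /=.
  by have -> : ((n + r.*2)%:Z - 1 - (n + r.*2 - 1 - k)%:Z = k%:Z)%R by lia.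
apply: sP => // d ds.
have := pxz (absz (k%:Z + d - r%:Z)%R) ltac:(lia).
by have -> : (r%:Z + (`|(k%:Z + d - r%:Z)%R|%N : int) = k%:Z + d)%R by lia.
Qed.

(* The words that follow w in Y when x(0) ... x(n + 2r - 1) is a preimage of w
   with last 2r letters [b] and follower set [F]. *)
Definition block_followers (b : 'I_r.*2 -> A) (F : set (seq A)) : set (seq B) :=
  [set u | exists2 z, X z & [/\ forall k : 'I_r.*2, z (Posz k) = b k,
     F (word_at z r.*2 (size u)) & word_at (phi z) r (size u) = u]].

Definition last_block (n : nat) (x : config A) : 'I_r.*2 -> A :=
  fun k => x (n%:Z + k%:Z)%R.

(** A letter of [phi x] sees [r] letters on each side, so [u] after [w] depends on the last [2r]
    letters of a preimage of [w] and the [size u] letters after it. Conversely, any continuation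
    allowed by the follower set of that preimage is realised by a point of [X]. *)
Lemma follower_set_preimages (n : nat) x : X x ->
  follower_set Y (word_at (phi x) r n) =
  \bigcup_(x' in [set x' | X x' /\ word_at (phi x') r n = word_at (phi x) r n])
    block_followers (last_block n x') (follower_set X (word_at x' 0 (n + r.*2))).
Proof.
move=> Xx; apply/seteqP; split=> u.
  move=> /(follower_setP _ _ _ _ shiftY)[_ /(phi_surj)[x' Xx' <-] [x'x x'u]].
  exists x' => /=; first by split=> //; apply/word_at_eqP.
  exists (shift_by n x'); first exact: shift_by_mem.
  split.
  - by move=> k; rewrite /shift_by /last_block addrC.
  - rewrite word_at_shift_by; apply/(follower_setP _ _ _ _ shiftX).
    exists x' => //; split=> //; rewrite size_word_at.
    by congr word_at; lia.
  - by rewrite phi_shift_by// word_at_shift_by.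
move=> [x' [Xx' /word_at_eqP x'x] [z Xz [zb + zu]]].
(* [y] starts with the preimage word of [x'] and goes on as [z] does after its first [2r]
   letters. *)
move=> /(follower_setP _ _ _ _ shiftX)[y Xy]; rewrite size_word_at => -[yx' yz].
apply/(follower_setP _ _ _ _ shiftY); exists (phi y); first exact: phi_fun.
split=> [k kn|].
  rewrite -x'x//; have := @phi_word y x' 0%R 0%R n Xy Xx' yx' k kn.
  by rewrite !add0r.
rewrite -{2}zu; apply/word_at_eqP => k ku.
have := @phi_word y z (Posz n) 0%R (size u) Xy Xz _ k ku.
rewrite add0r [(_ + n%:Z)%R]addrC; apply => {ku} {}k ku; rewrite add0r.
(* From position [n] on, [y] agrees with [z]: first through the common last block, then through the
   follower word. *)
have [kr|kr] := ltnP k r.*2.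
  by have := yx' (n + k)%N ltac:(lia); have := zb (Ordinal kr); rewrite /last_block /= add0r => -> ->.
move/word_at_eqP: yz => /(_ (k - r.*2)%N ltac:(lia)).
have -> : (0 + (n + r.*2)%:Z + (k - r.*2)%:Z = n%:Z + k%:Z)%R by lia.
by have -> : (r.*2%:Z + (k - r.*2)%:Z = k%:Z)%R by lia.
Qed.

Lemma card_follower_sets_le (n : nat) :
  (#|` fset_set (follower_sets Y n)| <=
   (#|A| ^ r.*2 * #|` fset_set (follower_sets X (n + r.*2))|).+1
     ^ (#|A| ^ (r + s) * #|A| ^ (r + s)))%N.
Proof.
pose S := fset_set (follower_sets X (n + r.*2)).
pose W : finType := ({ffun 'I_(r + s) -> A} * {ffun 'I_(r + s) -> A})%type.
(* [None] stands for end blocks of no preimage; it accounts for the successor in the bound. *)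
pose V : finType := option ({ffun 'I_r.*2 -> A} * S)%type.
pose decode (e : {ffun W -> V}) : set (seq B) :=
  [set u | exists t b F, e t = Some (b, F) /\ block_followers b (val F) u].
(* A word of Y is encoded by sending the end blocks of each of its preimages to
   the last block and the follower set of that preimage. *)
suff /card_fset_set_le_range : follower_sets Y n `<=` range decode.
  by rewrite card_ffun card_prod card_option card_prod !card_ffun !card_ord -cardfE.
move=> _ [w [[_ /(phi_surj)[x0 Xx0 <-] [i wi]] wn] <-].
(* With [w] placed at position [r], its preimages start at position 0. *)
have [x Xx ->] : exists2 x, X x & w = word_at (phi x) r n.
  exists (shift_by (i - r%:Z) x0); first exact: shift_by_mem.
  by rewrite phi_shift_by// word_at_shift_by -wi wn; congr word_at; lia.
pose pre t x' := [/\ X x', word_at (phi x') r n = word_at (phi x) r n & word_ends n x' = t].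
have /choice[e eP] : forall t, exists v : V,
    if v is Some (b, F) then exists x', [/\ pre t x', b =1 last_block n x' &
       val F = follower_set X (word_at x' 0 (n + r.*2))]
    else ~ exists x', pre t x'.
  move=> t; have [[x' px']|npx] := pselect (exists x', pre t x'); last by exists None.
  have [Xx' _ _] := px'.
  have SF : follower_set X (word_at x' 0 (n + r.*2)) \in S.
    rewrite in_fset_set; last exact: finite_follower_sets.
    exact/mem_set/follower_sets_word_at.
  exists (Some ([ffun k => last_block n x' k], [` SF]%fset)).
  by exists x'; split=> // k; rewrite ffunE.
exists [ffun t => e t] => //; rewrite follower_set_preimages//.
apply/seteqP; split=> u.
  move=> [t [b [F [+ bFu]]]]; rewrite ffunE => et.
  have := eP t; rewrite et => -[x' [[Xx' x'x _] bx' Fx']].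
  by exists x' => //; rewrite -Fx'; have /funext <- := bx'.
move=> [x' [Xx' x'x] x'u]; exists (word_ends n x').
have := eP (word_ends n x'); rewrite ffunE.
case: (e _) => [[b F]|]; last by move=> []; exists x'.
move=> [z [[Xz zx ends] bz Fz]]; exists b, F; split=> //.
(* The chosen preimage [z] may differ from [x'] as a point, but equal end blocks force the same word
   on the window, hence the same last block and follower set. *)
have zx' := word_ends_inj Xz Xx' (etrans zx (esym x'x)) ends.
rewrite Fz zx'; suff -> : (b : 'I_r.*2 -> A) = last_block n x' by [].
apply/funext => k; rewrite bz /last_block.
by move/word_at_eqP: zx' => /(_ (n + k)%N); rewrite !add0r; apply; have := ltn_ord k; lia.
Qed.

End Radii.
End Conjugacy.

(** * Exponential growth rates *)

Section Growth.
Variable R : realType.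

Lemma ln_natr_ge0 (n : nat) : (0 <= ln (n%:R : R))%R.
Proof. by case: n => [|n]; [rewrite ln0|rewrite ln_ge0// ler1n]. Qed.

Lemma growth_rate_ge0 (a : nat -> nat) (n : nat) :
  (0 <= n%:R^-1 * ln ((a n)%:R : R))%R.
Proof. by rewrite mulr_ge0 ?invr_ge0 ?ler0n// ln_natr_ge0. Qed.

(** The terms are nonnegative, so a zero upper limit is a genuine limit; the rest of the estimate
    can then be done with real sequences. *)
Lemma limn_esup_growth_rate0P (a : nat -> nat) :
  limn_esup (fun n => (n%:R^-1 * ln ((a n)%:R : R))%:E) = 0%E <->
  (n%:R^-1 * ln ((a n)%:R : R))%R @[n --> \oo] --> (0 : R)%R.
Proof.
split=> [a0|a0].
  apply: (@fine_cvg _ _ _ _ (fun n => (n%:R^-1 * ln ((a n)%:R : R))%:E)).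
  apply: limn_esup_le_cvg; first by rewrite a0.
  by move=> n; rewrite lee_fin; exact: growth_rate_ge0.
have [] // := @cvg_limn_einf_sup _
  (fun n => (n%:R^-1 * ln ((a n)%:R : R))%:E) 0%:E.
by apply: cvg_EFin => //; exact: nearW.
Qed.

Lemma growth_rate_cvg0 (a b : nat -> nat) (C K m : nat) :
  (forall n, 0 < a n)%N ->
  (forall n, b n <= (C * a (n + m)).+1 ^ K)%N ->
  (n%:R^-1 * ln ((a n)%:R : R))%R @[n --> \oo] --> (0 : R)%R ->
  (n%:R^-1 * ln ((b n)%:R : R))%R @[n --> \oo] --> (0 : R)%R.
Proof.
move=> a_gt0 b_le a0.
pose u n : R := (n%:R^-1 * ln ((a n)%:R : R))%R.
(* The majorant comes from [ln (b n) <= K (ln (C + 1) + ln (a (n + m)))] divided by [n], with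
   [(n + m) / n <= m + 1]. *)
pose h n : R := (K%:R * ln (C.+1%:R : R) * (n%:R^-1) + K%:R * m.+1%:R * u (n + m)%N)%R.
have h0 : h n @[n --> \oo] --> (0 : R)%R.
  have -> : (0 = K%:R * ln (C.+1%:R : R) * 0 + K%:R * m.+1%:R * 0 :> R)%R by rewrite !mulr0 addr0.
  apply: cvgD; apply: cvgM; try exact: cvg_cst.
    by rewrite -(cvg_shiftn 1%N); under eq_fun do rewrite addn1; exact: cvg_harmonic.
  by rewrite (cvg_shiftn m u).
apply: (@squeeze_cvgr _ _ _ _ (fun=> 0%R) h) => //; last exact: cvg_cst.
near=> n; rewrite growth_rate_ge0/=.
have n0 : (0 < n)%N by near: n; exact: nbhs_infty_gt.
have nR0 : (0 < n%:R :> R)%R by rewrite ltr0n.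
have := a_gt0 (n + m)%N => anm.
have lnb : (ln ((b n)%:R : R) <= K%:R * (ln C.+1%:R + ln (a (n + m)%N)%:R))%R.
  (* If [b n = 0], the convention [ln 0 = 0] applies. *)
  have [->|bn0] := posnP (b n).
    by rewrite ln0// mulr_ge0// addr_ge0// ln_natr_ge0.
  rewrite -lnM ?posrE ?ltr0n// -natrM mulr_natl -lnXn ?ltr0n ?muln_gt0 ?anm//.
  rewrite -natrX ler_ln ?posrE ?ltr0n ?expn_gt0 ?muln_gt0 ?anm// ler_nat.
  (* Positivity of [a] gives [C a + 1 <= (C + 1) a]; exponent 0 is separate since [leq_exp2r] needs
     a positive one. *)
  by apply: leq_trans (b_le n) _; case: K {b_le h h0} => // K; rewrite leq_exp2r// mulSn -add1n leq_add2r.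
have una : (ln (a (n + m)%N)%:R <= m.+1%:R * n%:R * u (n + m)%N :> R)%R.
  rewrite /u mulrA -[leLHS]mul1r ler_wpM2r ?ln_natr_ge0//.
  rewrite ler_pdivlMr ?ltr0n ?addn_gt0 ?n0// mul1r -natrM ler_nat.
  by rewrite mulSn leq_add2l leq_pmulr.
rewrite mulrC ler_pdivrMr// /h mulrDl; apply: le_trans lnb _.
rewrite mulrDr -!mulrA mulVf ?gt_eqF// mulr1 lerD2l ler_wpM2l//.
apply: le_trans una _; rewrite /u le_eqVlt; apply/orP; left; apply/eqP; ring.
Unshelve. all: by end_near. Qed.

End Growth.

Theorem corollary3p5 (R : realType) (A B : finType)
    (X : set (config A)) (Y : set (config B))
    (shiftX : shift_space X) (shiftY : shift_space Y)
    (X0 : X !=set0) (Y0 : Y !=set0) (XY : conjugate_shifts X Y)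
    (hX : follower_entropy R X = 0%E) :
  follower_entropy R Y = 0%E.
Proof.
have [phi [phi_cont phi_bij phi_shift]] := XY.
have [r rP] := phi_local shiftX phi_cont phi_shift.
have [s sP] := phi_inv_local shiftX phi_cont phi_bij phi_shift.
apply/limn_esup_growth_rate0P; move/limn_esup_growth_rate0P: hX.
(* Here [m = 2r], [C = |A|^(2r)] and [K = |A|^(2(r + s))]. *)
apply: growth_rate_cvg0 => n; first exact: follower_sets_gt0.
exact: (card_follower_sets_le shiftX shiftY phi_bij phi_shift rP sP).
Qed.
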